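(* Let $X,Y$ be Banach spaces with $X$ continuously embedded in $Y$. Assume that $\Phi_1,\Phi_2$ are lower semi-continuous semi-norms on $Y$ (in the sense defined in the context), are coercive on $X$, possess a finite-dimensional kernel and satisfy $$c_i\|u\|_X\le\|u\|_Y+\Phi_i(u)\le C_i\|u\|_X\quad\text{for all }u\in X$$ for constants $0<c_i<C_i<\infty$, $i=1,2$, independent of $u$. Then $\Phi_1\,\Box\,\Phi_2$ satisfies $$c\|u\|_X\le\|u\|_Y+(\Phi_1\,\Box\,\Phi_2)(u)\le C\|u\|_X\quad\text{for all }u\in X$$ for constants $0<c<C<\infty$ independent of $u$. Moreover, if $X$ is compactly embedded in $Y$, then $\Phi_1\,\Box\,\Phi_2$ is a lower semi-continuous semi-norm on $Y$ and coercive on $X$, i.e., there exists a $C'>0$ such that $$\|u-Pu\|_X\le C'(\Phi_1\,\Box\,\Phi_2)(u)\quad\text{for all }u\in X,$$ where $P:Y\to\ker(\Phi_1)+\ker(\Phi_2)$ is a linear, continuous and onto projector on the kernel of $\Phi_1\,\Box\,\Phi_2$ (this kernel being $\ker(\Phi_1)+\ker(\Phi_2)$).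
   Context: The infimal convolution of $\Phi_1,\Phi_2:Y\to[0,\infty]$ is $(\Phi_1\,\Box\,\Phi_2)(u)=\inf_{v\in Y}\Phi_1(u-v)+\Phi_2(v)$ for $u\in Y$. A functional $\Phi:Y\to[0,\infty]$ on a real Banach space $Y$ is called a lower semi-continuous semi-norm on $Y$ if: (1) $\Phi$ is proper (finite somewhere); (2) $\Phi(\lambda u)=|\lambda|\Phi(u)$ for all $\lambda\in\mathbb{R}$, $u\in Y$; (3) $\Phi(u+v)\le\Phi(u)+\Phi(v)$ for all $u,v\in Y$; (4) $\Phi(u)\le\liminf_{n\to\infty}\Phi(u^n)$ whenever $u^n\to u$ in $Y$; (5) there is a linear, continuous and onto projection operator $P:Y\to\ker(\Phi)$, where $\ker(\Phi)=\{u\in Y:\Phi(u)=0\}$. For $X$ continuously embedded in $Y$, $\Phi$ is called coercive on $X$ if, with $P:Y\to\ker(\Phi)$ the projection associated with $\Phi$, there exists a constant $C>0$ such that $\|u-Pu\|_X\le C\,\Phi(u)$ for all $u\in X$.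
   Formalization: The formal theorem additionally assumes that each Φ_i is +∞ on Y \ X (Φ_i(u) < ∞ implies u ∈ X); without such an assumption the norm estimate and the coercivity of the infimal convolution can fail. *)

(* Defs.v *)
From HB Require Import structures.
From mathcomp Require Import all_boot all_order all_algebra.
From mathcomp Require Import all_classical all_reals all_analysis.

Set Implicit Arguments.
Unset Strict Implicit.
Unset Printing Implicit Defensive.

Import Order.TTheory GRing.Theory Num.Theory.
Import numFieldNormedType.Exports.

Local Open Scope classical_set_scope.
Local Open Scope ring_scope.
Local Open Scope ereal_scope.

Section InfimalConvolution.
Context {R : realType} {Y : completeNormedModType R}.
Implicit Types (Phi : Y -> \bar R) (P : {linear Y -> Y}).

Definition inf_conv Phi1 Phi2 (u : Y) : \bar R :=
  ereal_inf [set Phi1 (u - v)%R + Phi2 v | v in [set: Y]].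

Definition fker Phi : set Y := [set u | Phi u = 0].

(* A projection onto the kernel is encoded as an idempotent endomorphism of Y
   whose range is the kernel. *)
Definition kernel_projection Phi P : Prop :=
  [/\ continuous P, range P = fker Phi & forall u, P (P u) = P u].

(* In snorm_homo, 0 * +oo = 0. *)
Record lsc_seminorm Phi : Prop := LscSeminorm {
  snorm_ge0 : forall u, 0 <= Phi u ;
  snorm_proper : exists u, Phi u < +oo ;
  snorm_homo : forall (a : R) u, Phi (a *: u)%R = `|a|%:E * Phi u ;
  snorm_subadd : forall u v, Phi (u + v)%R <= Phi u + Phi v ;
  snorm_lsc : forall (u_ : nat -> Y) u,
    u_ @ \oo --> u -> Phi u <= limn_einf (fun n => Phi (u_ n)) ;
  snorm_proj : exists P, kernel_projection Phi P }.

Definition finite_dim (V : set Y) : Prop :=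
  exists (n : nat) (b : 'I_n -> Y),
    V = [set (\sum_(i < n) a i *: b i)%R | a in [set: 'I_n -> R]].

Definition set_sum (V W : set Y) : set Y :=
  [set (v + w)%R | v in V & w in W].

End InfimalConvolution.

Section Embedding.
Context {R : realType} {X Y : completeNormedModType R}.
Variable j : {linear X -> Y}.
Implicit Types (Phi : Y -> \bar R) (P : {linear Y -> Y}).

(* X, carrying its own norm, is identified with the subspace [range j] of Y. *)
Definition continuous_embedding : Prop := injective j /\ continuous j.

Definition compact_embedding : Prop :=
  continuous_embedding /\
  forall B : set X, bounded_set B -> precompact (j @` B).

Definition norm_equivalence Phi : Prop :=
  exists c C : R, [/\ (0 < c)%R, (c < C)%R &
    forall u : X,
      (c * `|u|)%:E <= `|j u|%:E + Phi (j u) <= (C * `|u|)%:E].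

(* The X-norm of u - P u only makes sense if u - P u lies in X: w is that
   element of X, unique because j is injective. *)
Definition coercive_along Phi P : Prop :=
  exists2 C : R, (0 < C)%R &
    forall u : X, exists2 w : X,
      j w = (j u - P (j u))%R & `|w|%:E <= C%:E * Phi (j u).

Definition coercive Phi : Prop :=
  exists2 P, kernel_projection Phi P & coercive_along Phi P.

End Embedding.

(* Main.v *)
(** Coercivity splits every decomposition [j x = (j x - v) + v] of finite cost [s]
    as [x = w1 + w2 + z] with [j z] in [K = ker Phi1 + ker Phi2] and the X-norms of
    [w1] and [w2] bounded by a multiple of [s]. Since [K] is finite-dimensional,
    the X- and Y-norms are comparable on it and (by Hahn-Banach) it is the range of
    a continuous projection. Comparing norms on [z] gives the lower estimate of the
    norm equivalence, and applying any projection onto [K] gives coercivity, which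
    in turn identifies the kernel. For lower semicontinuity the competitor [v] is
    changed by elements of the kernels so that it stays bounded in X, hence in a
    compact subset of Y. *)
Require Import Defs.
From HB Require Import structures.
From mathcomp Require Import all_boot all_order all_algebra.
From mathcomp Require Import all_classical all_reals all_analysis.
From mathcomp Require Import lra.
Import Order.TTheory GRing.Theory Num.Theory.
Import numFieldNormedType.Exports.
Local Open Scope classical_set_scope.
Local Open Scope ring_scope.

(** * Hahn-Banach through minimal sublinear functionals *)

Section HahnBanach.
Context {R : realType} {V : normedModType R}.
Implicit Types (q : V -> R) (a x y : V).

(** Homogeneity is only an inequality for positive scalars, a form that passes to infima;
    [sublinearZ] recovers equality by applying it to the inverse scalar. *)
Definition sublinear_le_norm q : Prop :=
  [/\ forall x y, q (x + y) <= q x + q y,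
      forall t x, 0 < t -> q (t *: x) <= t * q x &
      forall x, q x <= `|x|].

(** For sublinear [q] this is the greatest sublinear functional below [q] whose value at [- a] is at
    most [- q a]. *)
Definition tilt q a x : R :=
  inf [set q (x + t *: a) - t * q a | t in [set t | 0 <= t]].

Lemma sublinear0 q : sublinear_le_norm q -> q 0 = 0.
Proof.
move=> [qD _ qn]; apply/eqP; rewrite eq_le; apply/andP; split.
  by rewrite (le_trans (qn 0)) // normr0.
by have := qD 0 0; rewrite addr0 lerDl.
Qed.

Lemma sublinearZ q t x : sublinear_le_norm q -> 0 <= t -> q (t *: x) = t * q x.
Proof.
move=> sq; rewrite le_eqVlt => /predU1P[<-|t0].
  by rewrite scale0r mul0r sublinear0.
have [_ qZ _] := sq; apply/eqP; rewrite eq_le qZ //=.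
have := qZ t^-1 (t *: x); rewrite invr_gt0 scalerA mulVf ?gt_eqF// scale1r.
by move=> /(_ t0); rewrite mulrC ler_pdivlMr // mulrC.
Qed.

Lemma sublinear_opp q x : sublinear_le_norm q -> - q (- x) <= q x.
Proof.
move=> sq; have [qD _ _] := sq; rewrite lerNl -subr_ge0 opprK addrC.
by rewrite -(sublinear0 _ sq) -(subrr x) qD.
Qed.

Lemma sublinear_ge_norm q x : sublinear_le_norm q -> - `|x| <= q x.
Proof.
move=> sq; have [_ _ qn] := sq; apply: le_trans (sublinear_opp q x sq).
by rewrite lerN2 (le_trans (qn _)) // normrN.
Qed.

Lemma tilt_le q a x t : sublinear_le_norm q -> 0 <= t ->
  tilt q a x <= q (x + t *: a) - t * q a.
Proof.
move=> sq t0; apply: ge_inf; last by exists t.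
(* A lower bound of the set, obtained by splitting [s *: a] as the sum of [x + s *: a] and [- x]. *)
exists (- q (- x)) => _ [s s0 <-]; have [qD _ _] := sq.
rewrite -(sublinearZ q s a sq s0) lerBrDl lerBlDr.
by rewrite (_ : q (s *: a) = q (x + s *: a + - x)) ?qD // addrAC subrr add0r.
Qed.

Lemma le_tilt q a x r :
  (forall t, 0 <= t -> r <= q (x + t *: a) - t * q a) -> r <= tilt q a x.
Proof.
move=> h; apply: lb_le_inf; first by exists (q (x + 0 *: a) - 0 * q a), 0 => //=.
by move=> _ [t t0 <-]; exact: h.
Qed.

Lemma tilt_le_self q a x : sublinear_le_norm q -> tilt q a x <= q x.
Proof.
by move=> sq; have := tilt_le q a x 0 sq (lexx _); rewrite scale0r addr0 mul0r subr0.
Qed.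

Lemma tilt_opp q a : sublinear_le_norm q -> tilt q a (- a) <= - q a.
Proof.
move=> sq; have := tilt_le q a (- a) 1 sq ler01.
by rewrite scale1r addNr sublinear0 // mul1r add0r.
Qed.

(** Parameters [s] for [x] and [t] for [y] combine to [s + t] for [x + y]; a parameter [t] for [x]
    becomes [c * t] for [c *: x]. *)
Lemma tilt_sublinear q a : sublinear_le_norm q -> sublinear_le_norm (tilt q a).
Proof.
move=> sq; have [qD qZ qn] := sq; split.
- move=> x y; rewrite -lerBlDl; apply: le_tilt => t t0.
  rewrite lerBlDr -lerBlDl; apply: le_tilt => s s0.
  have := tilt_le q a (x + y) (s + t) sq (addr_ge0 s0 t0).
  have := qD (x + s *: a) (y + t *: a).
  by rewrite addrACA -scalerDl; lra.
- move=> c x c0; rewrite -ler_pdivrMl //; apply: le_tilt => t t0.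
  rewrite ler_pdivrMl //.
  have := tilt_le q a (c *: x) (c * t) sq (mulr_ge0 (ltW c0) t0).
  by have := qZ c (x + t *: a) c0; rewrite scalerDr scalerA; lra.
- by move=> x; exact: le_trans (tilt_le_self q a x sq) (qn x).
Qed.

(** Subadditivity is where the chain matters: the smaller of [p] and [q] bounds the infimum at
    [x + y] by [q x + p y]. *)
Lemma inf_chain_sublinear (A : set (V -> R)) :
  A !=set0 -> (forall q, A q -> sublinear_le_norm q) ->
  (forall p q, A p -> A q -> (forall x, p x <= q x) \/ (forall x, q x <= p x)) ->
  sublinear_le_norm (fun x => inf [set q x | q in A]) /\
  forall q x, A q -> inf [set q x | q in A] <= q x.
Proof.
move=> [q0 Aq0] sA tA.
have lei q x : A q -> inf [set q x | q in A] <= q x.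
  move=> Aq; apply: ge_inf; last by exists q.
  by exists (- `|x|) => _ [p Ap <-]; apply: sublinear_ge_norm; exact: sA.
have gei x r : (forall q, A q -> r <= q x) -> r <= inf [set q x | q in A].
  move=> h; apply: lb_le_inf; first by exists (q0 x); exists q0.
  by move=> _ [q Aq <-]; exact: h.
split=> //; split.
- move=> x y; rewrite -lerBlDl; apply: (gei) => p Ap.
  rewrite lerBlDr -lerBlDl; apply: (gei) => q Aq; rewrite lerBlDl.
  have [pDD _ _] := sA _ Ap; have [qDD _ _] := sA _ Aq.
  have [pq|qp] := tA _ _ Ap Aq.
    apply: le_trans (lei _ _ Ap) _; apply: le_trans (pDD _ _) _.
    by rewrite addrC lerD2l; exact: pq.
  apply: le_trans (lei _ _ Aq) _; apply: le_trans (qDD _ _) _.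
  by rewrite addrC lerD2r; exact: qp.
- move=> c x c0; rewrite -ler_pdivrMl //; apply: (gei) => q Aq.
  rewrite ler_pdivrMl //; have [_ qZ _] := sA _ Aq.
  exact: le_trans (lei _ _ Aq) (qZ _ _ c0).
- move=> x; have [_ _ qn] := sA _ Aq0; exact: le_trans (lei _ _ Aq0) (qn x).
Qed.

(* A sublinear functional that is minimal below q is odd, hence linear,
   because tilting it in any direction cannot lower it. *)
Lemma exists_linear_le q : sublinear_le_norm q ->
  exists2 f : {linear V -> R}, forall x, f x <= q x & forall x, `|f x| <= `|x|.
Proof.
move=> sq.
pose T := {p : V -> R | sublinear_le_norm p /\ forall x, p x <= q x}.
(* The order is reversed, so that the maximal element given by [Zorn] is a minimal sublinear
   functional below [q]. *)
pose le_rev (p p' : T) : bool := `[< forall x, sval p' x <= sval p x >].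
have [|||A tA|[m [sm mq]] mmin] := @Zorn T le_rev.
- by move=> p; apply/asboolP.
- move=> ? ? ? /asboolP h /asboolP h'; apply/asboolP => x.
  exact: le_trans (h' x) (h x).
- move=> [p hp] [p' hp'] /asboolP/= h /asboolP/= h'; apply: eq_exist.
  by apply/funext => x; apply/eqP; rewrite eq_le h h'.
- have [[p0 Ap0]|A0] := pselect (A !=set0); last first.
    (* The empty chain is bounded by [q] itself. *)
    have sq' : sublinear_le_norm q /\ forall x, q x <= q x by [].
    by exists (exist _ q sq') => s As; exfalso; apply: A0; exists s.
  have [||| s' le'] := @inf_chain_sublinear [set sval p | p in A].
  + by exists (sval p0); exists p0.
  + by move=> _ [p Ap <-]; exact: (svalP p).1.
  + move=> _ _ [p Ap <-] [p' Ap' <-].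
    by have [/asboolP|/asboolP] := tA p p' Ap Ap'; [right|left].
  have le0 p : A p -> forall x, inf [set q x | q in [set sval p | p in A]] <= sval p x.
    by move=> Ap x; apply: le'; exists p.
  have sq' := conj s' (fun x => le_trans (le0 _ Ap0 x) ((svalP p0).2 x)).
  exists (exist (fun p : V -> R => sublinear_le_norm p /\ forall x, p x <= q x) _ sq').
  by move=> s As; apply/asboolP => x /=; exact: le0.
have tiltm a : tilt m a = m.
  have st := conj (tilt_sublinear m a sm)
    (fun x => le_trans (tilt_le_self m a x sm) (mq x)).
  suff /(congr1 sval) : exist _ _ st = exist _ _ (conj sm mq) :> T by [].
  by apply: mmin; apply/asboolP => x /=; exact: tilt_le_self.
have mN a : m (- a) = - m a.
  apply/eqP; rewrite eq_le -{1}(tiltm a) tilt_opp //=.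
  by rewrite lerNl; exact: sublinear_opp.
have [mD mZ mn] := sm.
have mDD x y : m (x + y) = m x + m y.
  apply/eqP; rewrite eq_le mD /=.
  by have := mD (- x) (- y); rewrite -opprD !mN -opprD lerN2.
have mlin : linear m.
  move=> c x y; rewrite mDD; congr (_ + _); have [c0|c0] := leP 0 c.
    exact: sublinearZ.
  rewrite -[in LHS](opprK c) scaleNr mN sublinearZ ?oppr_ge0 1?ltW//.
  by rewrite -mulNr opprK.
pose L := GRing.isLinear.Build _ _ _ _ m mlin.
pose f : {linear V -> R} := HB.pack m L.
exists f => // x; rewrite ler_norml; apply/andP; split.
  exact: (sublinear_ge_norm m).
exact: mn.
Qed.

(** A linear [f] below the norm tilted at [a] has [f (- a)] at most minus the norm of [a], so [f a]
    is positive. *)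
Lemma exists_linear_neq0 a : a != 0 ->
  exists2 f : {linear V -> R}, f a != 0 & forall x, `|f x| <= `|x|.
Proof.
move=> a0.
have sn : sublinear_le_norm (fun x => `|x|).
  split=> // [x y|t x t0]; first exact: ler_normD.
  by rewrite normrZ gtr0_norm.
have [f fq fn] := exists_linear_le _ (tilt_sublinear _ a sn).
exists f => //; have := le_trans (fq (- a)) (tilt_opp _ a sn).
by rewrite linearN lerN2; apply: contraTneq => ->; rewrite normr_le0.
Qed.

End HahnBanach.

(** * Bounded coordinate functionals on a finite span *)

Section Coordinates.
Context {R : realType} {V : normedModType R}.
Implicit Types (f g : V -> R).

(** A predicate on plain functions, so that functionals built by sums or by case analysis need no
    bundled linear structure. *)
Definition bounded_functional f : Prop :=
  (forall c x y, f (c *: x + y) = c * f x + f y) /\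
  exists2 D, 0 <= D & forall x, `|f x| <= D * `|x|.

Lemma bounded_functional_of_linear (f : {linear V -> R}) :
  (forall x, `|f x| <= `|x|) -> bounded_functional f.
Proof.
move=> fn; split=> [c x y|]; first by rewrite linearP.
by exists 1 => // x; rewrite mul1r.
Qed.

Lemma bounded_functional0 : bounded_functional (fun=> 0).
Proof.
split=> [c x y|]; first by rewrite mulr0 addr0.
by exists 0 => // x; rewrite normr0 mul0r.
Qed.

Lemma bounded_functionalDZ f g c : bounded_functional f ->
  bounded_functional g -> bounded_functional (fun x => f x + c * g x).
Proof.
move=> [fl [D D0 fD]] [gl [E E0 gE]]; split=> [t x y|].
  by rewrite fl gl; lra.
exists (D + `|c| * E) => [|x]; first by rewrite addr_ge0 // mulr_ge0.
rewrite (le_trans (ler_normD _ _)) // mulrDl lerD // normrM -mulrA.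
exact: ler_wpM2l.
Qed.

Lemma bounded_functional_sum n (f : 'I_n -> V -> R) (c : 'I_n -> R) :
  (forall i, bounded_functional (f i)) ->
  bounded_functional (fun x => \sum_(i < n) f i x * c i).
Proof.
elim: n f c => [|n IH] f c hf.
  rewrite [X in bounded_functional X](_ : _ = fun=> 0); last first.
    by apply/funext => x; rewrite big_ord0.
  exact: bounded_functional0.
rewrite [X in bounded_functional X](_ : _ = fun x =>
  \sum_(i < n) f (widen_ord (leqnSn n) i) x * c (widen_ord (leqnSn n) i)
  + c ord_max * f ord_max x); last first.
  by apply/funext => x; rewrite big_ord_recr /= [in RHS]mulrC.
by apply: bounded_functionalDZ => //; apply: (IH (fun i => f (widen_ord _ i))).
Qed.

Lemma functional_sum f n (a : 'I_n -> R) (b : 'I_n -> V) :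
  bounded_functional f -> f (\sum_(i < n) a i *: b i) = \sum_(i < n) a i * f (b i).
Proof.
move=> [fl _]; have f0 : f 0 = 0.
  by have := fl 1 0 0; rewrite scaler0 addr0 mul1r; lra.
have fD x y : f (x + y) = f x + f y by have := fl 1 x y; rewrite scale1r mul1r.
have fZ c x : f (c *: x) = c * f x by have := fl c x 0; rewrite f0 !addr0.
by rewrite (big_morph f fD f0); apply: eq_bigr => i _; exact: fZ.
Qed.

Lemma bounded_coordinates_norm (Z : normedModType R) n
    (f : 'I_n -> V -> R) (c : 'I_n -> Z) :
  (forall i, bounded_functional (f i)) ->
  exists2 D, 0 <= D & forall x, `|\sum_(i < n) f i x *: c i| <= D * `|x|.
Proof.
elim: n f c => [|n IH] f c hf.
  by exists 0 => // x; rewrite big_ord0 normr0 mul0r.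
have [D D0 hD] := IH (fun i => f (widen_ord (leqnSn n) i))
  (fun i => c (widen_ord (leqnSn n) i)) (fun i => hf _).
have [_ [E E0 hE]] := hf ord_max.
exists (D + E * `|c ord_max|) => [|x]; first by rewrite addr_ge0 // mulr_ge0.
rewrite big_ord_recr /= (le_trans (ler_normD _ _)) // mulrDl lerD //.
by rewrite normrZ mulrAC ler_wpM2r.
Qed.

(* The family b need not be free. *)
Lemma span_coordinates n (b : 'I_n -> V) :
  exists2 f : 'I_n -> V -> R, forall i, bounded_functional (f i) &
    forall a : 'I_n -> R,
      \sum_(i < n) f i (\sum_(k < n) a k *: b k) *: b i = \sum_(i < n) a i *: b i.
Proof.
elim: n b => [|n IH] b.
  by exists (fun _ _ => 0) => [[]//|a]; rewrite !big_ord0.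
pose w (i : 'I_n) := widen_ord (leqnSn n) i.
have [f hf fE] := IH (fun i => b (w i)).
set e := b ord_max.
pose Q y := \sum_(i < n) f i y *: b (w i).
(* [g] reads the coefficient along [e]: [g = 0] if [e] is in the span of the earlier vectors,
   [g e = 1] otherwise. The last equation covers both cases. *)
have [g [hg g0 ge]] : exists g, [/\ bounded_functional g,
    forall a : 'I_n -> R, g (\sum_(k < n) a k *: b (w k)) = 0 &
    e = g e *: e + Q e - g e *: Q e].
  have [c0|c0] := eqVneq (e - Q e) 0.
    exists (fun=> 0); split=> //; first exact: bounded_functional0.
    by rewrite !scale0r add0r subr0; apply/eqP; rewrite -subr_eq0 c0.
  have [h hc hn] := exists_linear_neq0 _ c0.
  have hbf := bounded_functional_of_linear h hn.
  have hQ y : h (Q y) = \sum_(i < n) f i y * h (b (w i)) by exact: functional_sum.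
  (* This is [h (x - Q x)] normalised to be [1] at [e]; it vanishes on the earlier span because [Q]
     fixes that span. *)
  exists (fun x => 0 + (h (e - Q e))^-1 *
    (h x + (-1) * \sum_(i < n) f i x * h (b (w i)))); split.
  - apply: bounded_functionalDZ; first exact: bounded_functional0.
    apply: bounded_functionalDZ => //; exact: bounded_functional_sum.
  - by move=> a; rewrite -hQ /Q fE mulN1r subrr mulr0 add0r.
  - rewrite -hQ mulN1r -linearB add0r mulVf // !scale1r.
    by rewrite addrK.
(* The last index gets [g]; an earlier index [k] gets [f k] evaluated at [y - g y *: e]. *)
exists (fun i => oapp (fun k y => f k y + (- f k e) * g y) g
  (insub (val i) : option 'I_n)).
  move=> i; case: insubP => //= k _ _; exact: bounded_functionalDZ.
move=> a.
have insubw k : insub (val (w k)) = Some k :> option 'I_n by rewrite valK.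
have insubm : insub (val (ord_max : 'I_n.+1)) = None :> option 'I_n.
  by apply: insubF; rewrite /= ltnn.
set y := \sum_(k < n.+1) a k *: b k.
have yE : y = \sum_(k < n) a (w k) *: b (w k) + a ord_max *: e.
  by rewrite /y big_ord_recr.
set v := \sum_(k < n) _ in yE.
have fy k : f k y = f k v + a ord_max * f k e.
  by have [fl _] := hf k; rewrite yE addrC fl addrC.
have gy : g y = a ord_max * g e.
  by have [gl _] := hg; rewrite yE addrC gl /v g0 addr0.
rewrite big_ord_recr /= insubm /= -/e.
(* Summed over [k], these terms give [v] plus a multiple of [Q e], which the equation [ge] turns
   into the missing part of [a ord_max *: e]. *)
have termE k : (f k y + - f k e * g y) *: b (w k) =
    f k v *: b (w k) + (a ord_max - a ord_max * g e) *: (f k e *: b (w k)).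
  by rewrite fy gy -addrA scalerDl scalerA; congr (_ + _ *: _); lra.
under eq_bigr => i _ do rewrite insubw /= termE.
rewrite big_split /= -scaler_sumr (fE (fun k => a (w k))) -/v -/(Q e).
rewrite gy [RHS]yE -addrA; congr (_ + _).
by rewrite [in RHS]ge !scalerDr scalerN scalerBl !scalerA addrC addrA.
Qed.

End Coordinates.

(** * Projections, lifts and sums of finite-dimensional subspaces *)

Section FiniteDimension.
Context {R : realType} {Y : completeNormedModType R}.
Implicit Types (V W : set Y).

Lemma finite_dim_coordinates V : finite_dim V ->
  exists n (b : 'I_n -> Y) (f : 'I_n -> Y -> R),
    [/\ forall a : 'I_n -> R, V (\sum_(i < n) a i *: b i),
        forall i, V (b i),
        forall i, bounded_functional (f i) &
        forall y, V y -> \sum_(i < n) f i y *: b i = y].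
Proof.
move=> [n [b VE]]; have [f hf fE] := span_coordinates n b.
have Vs (a : 'I_n -> R) : V (\sum_(i < n) a i *: b i) by rewrite VE; exists a.
exists n, b, f; split=> // [i|y]; last by rewrite VE => -[a _ <-]; exact: fE.
rewrite [b i](_ : _ = \sum_(k < n) (k == i)%:R *: b k) ?Vs//.
rewrite (bigD1 i) //= eqxx scale1r big1 ?addr0// => k /negPf ->.
by rewrite scale0r.
Qed.

Lemma finite_dim_projection V : finite_dim V ->
  exists P : {linear Y -> Y},
    [/\ continuous P, range P = V & forall y, P (P y) = P y].
Proof.
move=> /finite_dim_coordinates[n [b [f [Vs Vb hf fE]]]].
pose p y := \sum_(i < n) f i y *: b i.
have plin : linear p.
  move=> c x y; rewrite /p scaler_sumr -big_split; apply: eq_bigr => i _.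
  by have [fl _] := hf i; rewrite fl scalerDl scalerA.
pose L := GRing.isLinear.Build _ _ _ _ p plin.
pose P : {linear Y -> Y} := HB.pack p L.
exists P; split.
- apply: bounded_linear_continuous; apply/linear_boundedP.
  have [D D0 hD] := bounded_coordinates_norm Y n f b hf.
  exists D; split=> [|r Dr x]; first exact: num_real.
  by rewrite (le_trans (hD x)) // ler_wpM2r // ltW.
- apply/seteqP; split=> [_ [y _ <-]|y Vy]; first exact: Vs.
  by exists y => //; exact: fE.
- by move=> y; apply: fE; exact: Vs.
Qed.

(** Lift the spanning vectors through [j]: by injectivity [x] is the combination of the lifts whose
    coefficients are the bounded coordinates of [j x]. *)
Lemma finite_dim_lift_bound (X : normedModType R) (j : {linear X -> Y}) V :
  injective j -> finite_dim V -> V `<=` range j ->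
  exists2 D, 0 <= D & forall x, V (j x) -> `|x| <= D * `|j x|.
Proof.
move=> jinj /finite_dim_coordinates[n [b [f [_ Vb hf fE]]]] Vj.
have [c cE] : exists c : 'I_n -> X, forall i, j (c i) = b i.
  have /choice[c cE] : forall i, exists x, j x = b i.
    by move=> i; have [x _ <-] := Vj _ (Vb i); exists x.
  by exists c.
have [D D0 hD] := bounded_coordinates_norm X n f c hf.
exists D => // x /fE jx; rewrite {1}[x](_ : _ = \sum_(i < n) f i (j x) *: c i) //.
apply: jinj; rewrite linear_sum -{1}jx.
by apply: eq_bigr => i _; rewrite linearZ -cE.
Qed.

(** Take bounded coordinates for the two spanning families put together; the first block gives [v],
    the second [w]. The sum need not be direct, since the joint family need not be free. *)
Lemma finite_dim_sum_decomposition V W : finite_dim V -> finite_dim W ->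
  finite_dim (set_sum V W) /\
  exists2 D, 0 <= D & forall y, set_sum V W y ->
    exists v w, [/\ V v, W w, v + w = y, `|v| <= D * `|y| & `|w| <= D * `|y|].
Proof.
move=> fdV fdW; have [n [b VE]] := fdV; have [m [c WE]] := fdW.
pose d (i : 'I_(n + m)) := match fintype.split i with inl k => b k | inr k => c k end.
have dl k : d (lshift m k) = b k.
  by rewrite /d -[lshift m k]/(unsplit (inl k)) unsplitK.
have dr k : d (rshift n k) = c k.
  by rewrite /d -[rshift n k]/(unsplit (inr k)) unsplitK.
have sumE (a : 'I_(n + m) -> R) : \sum_(i < n + m) a i *: d i =
    \sum_(i < n) a (lshift m i) *: b i + \sum_(i < m) a (rshift n i) *: c i.
  by rewrite big_split_ord /=; congr (_ + _); apply: eq_bigr => i _;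
    rewrite ?dl ?dr.
have VWE : set_sum V W = [set \sum_(i < n + m) a i *: d i | a in [set: 'I_(n + m) -> R]].
  apply/seteqP; split=> [y [v]|_ [a _ <-]].
    rewrite {1}VE => -[a _ <-] [w]; rewrite {1}WE => -[e _ <-] <-.
    exists (fun i => match fintype.split i with inl k => a k | inr k => e k end) => //.
    rewrite sumE; congr (_ + _); apply: eq_bigr => i _; congr (_ *: _).
      by rewrite -[lshift m i]/(unsplit (inl i)) unsplitK.
    by rewrite -[rshift n i]/(unsplit (inr i)) unsplitK.
  rewrite sumE; exists (\sum_(i < n) a (lshift m i) *: b i).
    by rewrite VE; exists (fun i => a (lshift m i)).
  exists (\sum_(i < m) a (rshift n i) *: c i) => //.
  by rewrite WE; exists (fun i => a (rshift n i)).
split; first by exists (n + m)%N, d.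
have [f hf fE] := span_coordinates _ d.
have [D D0 hD] := bounded_coordinates_norm Y n _ b (fun i => hf (lshift m i)).
have [E E0 hE] := bounded_coordinates_norm Y m _ c (fun i => hf (rshift n i)).
exists (D + E) => [|y]; first exact: addr_ge0.
rewrite VWE => -[a _ ay]; have := fE a; rewrite ay sumE => yE.
exists (\sum_(i < n) f (lshift m i) y *: b i).
exists (\sum_(i < m) f (rshift n i) y *: c i); split=> //.
- by rewrite VE; exists (fun i => f (lshift m i) y).
- by rewrite WE; exists (fun i => f (rshift n i) y).
- by rewrite (le_trans (hD y)) // ler_wpM2r // lerDl.
- by rewrite (le_trans (hE y)) // ler_wpM2r // lerDr.
Qed.

End FiniteDimension.

Local Open Scope ereal_scope.

(** * Algebraic properties of the infimal convolution *)

Section Seminorm.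
Context {R : realType} {Y : completeNormedModType R}.
Implicit Types (Phi : Y -> \bar R).

Lemma seminorm0 Phi : lsc_seminorm Phi -> Phi 0%R = 0.
Proof. by move=> sn; rewrite -(scale0r 0%R) (snorm_homo sn) normr0 mul0e. Qed.

Lemma seminormN Phi u : lsc_seminorm Phi -> Phi (- u)%R = Phi u.
Proof.
by move=> sn; rewrite -scaleN1r (snorm_homo sn) normrN normr1 mul1e.
Qed.

Lemma seminorm_kerD Phi u k : lsc_seminorm Phi -> fker Phi k ->
  Phi (u + k)%R = Phi u.
Proof.
move=> sn k0; apply/eqP; rewrite eq_le; apply/andP; split.
  by rewrite (le_trans (snorm_subadd sn _ _)) // k0 adde0.
rewrite -[in leLHS](addrK k u) (le_trans (snorm_subadd sn _ _)) //.
by rewrite seminormN // k0 adde0.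
Qed.

Variables (Phi1 Phi2 : Y -> \bar R).

Lemma inf_conv_le u v : inf_conv Phi1 Phi2 u <= Phi1 (u - v)%R + Phi2 v.
Proof. by apply: ereal_inf_lbound; exists v. Qed.

Lemma le_inf_conv u r :
  (forall v, Phi1 (u - v)%R + Phi2 v < +oo -> r <= Phi1 (u - v)%R + Phi2 v) ->
  r <= inf_conv Phi1 Phi2 u.
Proof.
move=> h; apply: le_ereal_inf_tmp => _ [v _ <-].
have [/h//|] := ltP (Phi1 (u - v)%R + Phi2 v) +oo.
by rewrite leye_eq => /eqP ->; rewrite leey.
Qed.

Context (sn1 : lsc_seminorm Phi1) (sn2 : lsc_seminorm Phi2).

Lemma inf_conv_ge0 u : 0 <= inf_conv Phi1 Phi2 u.
Proof.
by apply: le_inf_conv => v _; rewrite adde_ge0 // snorm_ge0.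
Qed.

Lemma inf_conv_set_sum u :
  set_sum (fker Phi1) (fker Phi2) u -> inf_conv Phi1 Phi2 u = 0.
Proof.
move=> [v v0 [w w0 <-]]; apply/eqP; rewrite eq_le inf_conv_ge0 andbT.
by rewrite (le_trans (inf_conv_le _ w)) // addrK v0 w0 adde0.
Qed.

Lemma inf_conv0 : inf_conv Phi1 Phi2 0%R = 0.
Proof.
by apply: inf_conv_set_sum; exists 0%R;
  [exact: seminorm0|exists 0%R; [exact: seminorm0|rewrite addr0]].
Qed.

(** A competitor [v] for [u] rescales to [a *: v]; applied to the inverse of [a], the same
    inequality yields equality in [inf_convZ]. *)
Lemma inf_convZ_le a u : (a != 0)%R ->
  inf_conv Phi1 Phi2 (a *: u)%R <= `|a|%:E * inf_conv Phi1 Phi2 u.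
Proof.
move=> a0; have a_gt0 : (0 < `|a|)%R by rewrite normr_gt0.
rewrite -lee_pdivrMl //; apply: le_inf_conv => v _; rewrite lee_pdivrMl //.
rewrite (le_trans (inf_conv_le _ (a *: v)%R)) // -scalerBr.
by rewrite (snorm_homo sn1) (snorm_homo sn2) muleDr // ge0_adde_def // inE snorm_ge0.
Qed.

Lemma inf_convZ a u :
  inf_conv Phi1 Phi2 (a *: u)%R = `|a|%:E * inf_conv Phi1 Phi2 u.
Proof.
have [->|a0] := eqVneq a 0%R; first by rewrite scale0r normr0 mul0e inf_conv0.
apply/eqP; rewrite eq_le inf_convZ_le //=.
have a_gt0 : (0 < `|a|)%R by rewrite normr_gt0.
rewrite -lee_pdivlMl // -normfV.
have := inf_convZ_le (a^-1)%R (a *: u)%R; rewrite scalerA mulVf // scale1r.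
by apply; rewrite invr_eq0.
Qed.

Lemma inf_convD u v : inf_conv Phi1 Phi2 (u + v)%R <=
  inf_conv Phi1 Phi2 u + inf_conv Phi1 Phi2 v.
Proof.
(* The infima are handled one at a time, with infinite values set aside so that finite terms can be
   moved across; competitors [x] and [y] combine to [x + y]. *)
have step x : inf_conv Phi1 Phi2 (u + v)%R <=
    Phi1 (u - x)%R + Phi2 x + inf_conv Phi1 Phi2 v.
  have [fx|] := ltP (Phi1 (u - x)%R + Phi2 x) +oo; last first.
    rewrite leye_eq => /eqP ->; rewrite addye ?leey// gt_eqF //.
    by rewrite (lt_le_trans _ (inf_conv_ge0 v)).
  have fin : Phi1 (u - x)%R + Phi2 x \is a fin_num.
    by rewrite ge0_fin_numE // adde_ge0 // snorm_ge0.
  rewrite -leeBlDl //; apply: le_inf_conv => y _; rewrite leeBlDl //.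
  apply: le_trans (inf_conv_le _ (x + y)%R) _.
  rewrite addeACA; apply: leeD; last exact: snorm_subadd.
  by rewrite opprD addrACA; exact: snorm_subadd.
have [fv|] := ltP (inf_conv Phi1 Phi2 v) +oo; last first.
  rewrite leye_eq => /eqP ->; rewrite addey ?leey// gt_eqF //.
  by rewrite (lt_le_trans _ (inf_conv_ge0 u)).
have fin : inf_conv Phi1 Phi2 v \is a fin_num.
  by rewrite ge0_fin_numE // inf_conv_ge0.
by rewrite -leeBlDr //; apply: le_inf_conv => x _; rewrite leeBlDr.
Qed.

End Seminorm.

(** * Lower semicontinuity by sequences and by neighbourhoods *)

Section LowerSemicontinuity.
Context {R : realType}.

Lemma lte_between (a b : \bar R) : a < b -> exists r : R, a < r%:E /\ r%:E < b.
Proof.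
case: a b => [p| |] [q| |] //= pq; rewrite ?ltNyr//.
- exists ((p + q) / 2)%R; move: pq; rewrite !lte_fin => pq.
  by rewrite midf_lt // (le_lt_trans _ (_ : (p + q) / 2 < q))%R //; lra.
- by exists (p + 1)%R; rewrite lte_fin ltry ltrDl.
- by exists (q - 1)%R; rewrite lte_fin ltNyr gtrBl.
- by exists 0%R; rewrite ltry ltNyr.
Qed.

(** Splits a threshold for a sum into one for each summand. When both are finite, each gives up half
    of the gap above [r]. *)
Lemma lte_addP (r : R) (a b : \bar R) : 0 <= a -> 0 <= b -> r%:E < a + b ->
  exists r1 r2 : R, [/\ r1%:E < a, r2%:E < b & (r <= r1 + r2)%R].
Proof.
case: a b => [p| |] [q| |] //= p0 q0; rewrite -?EFinD ?lte_fin => rpq.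
- exists (p - (p + q - r) / 2)%R, (q - (p + q - r) / 2)%R.
  by rewrite !lte_fin; split; lra.
- by exists (p - 1)%R, (r - p + 1)%R; rewrite lte_fin ltry; split=> //; lra.
- by exists (r - q + 1)%R, (q - 1)%R; rewrite lte_fin ltry; split=> //; lra.
- by exists r, 0%R; rewrite !ltry addr0.
Qed.

Lemma le_limn_einf (f : (\bar R)^nat) (r : \bar R) :
  (\forall n \near \oo, r <= f n) -> r <= limn_einf f.
Proof.
move=> [N _ hN]; rewrite limn_einf_lim; apply: lime_ge; first exact: is_cvg_einfs.
exists N => // n /= Nn; apply: le_ereal_inf_tmp => _ [k /= nk <-].
by apply: hN; exact: leq_trans nk.
Qed.

Lemma limn_einf_le (f : (\bar R)^nat) (r : \bar R) :
  (forall n, f n <= r) -> limn_einf f <= r.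
Proof.
move=> fr; rewrite limn_einf_lim; apply: lime_le; first exact: is_cvg_einfs.
exists 0%N => // n _; apply: le_trans (fr n).
by apply: ereal_inf_lbound; exists n => //=.
Qed.

Context {Y : completeNormedModType R}.
Implicit Type Phi : Y -> \bar R.

(** Otherwise points within [n.+1%:R^-1] of [u] with values at most [r] would converge to [u] and
    contradict sequential lower semicontinuity. *)
Lemma near_gt_of_seq_lsc Phi (u : Y) (r : R) :
  (forall u_ : nat -> Y, u_ @ \oo --> u -> Phi u <= limn_einf (Phi \o u_)) ->
  r%:E < Phi u -> \forall v \near u, r%:E < Phi v.
Proof.
move=> lsc ru; apply: contrapT => nr.
have /choice[u_ u_P] : forall n : nat, exists v,
    (`|u - v| < n.+1%:R^-1)%R /\ Phi v <= r%:E.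
  move=> n; apply: contrapT => hn; apply: nr; apply/nbhs_normP.
  exists n.+1%:R^-1%R => /=; first by rewrite invr_gt0 ltr0n.
  by move=> v uv; rewrite ltNge; apply/negP => vr; apply: hn; exists v.
have cu : u_ @ \oo --> u.
  apply/cvgrPdist_lt => e e0; have := near_infty_natSinv_lt (PosNum e0).
  by apply: filterS => n; apply: lt_trans; exact: (u_P n).1.
have := lt_le_trans ru (le_trans (lsc _ cu) (limn_einf_le _ _ (fun n => (u_P n).2))).
by rewrite ltxx.
Qed.

Lemma seq_lsc_of_near_gt Phi (u : Y) (u_ : nat -> Y) :
  (forall r : R, r%:E < Phi u -> \forall v \near u, r%:E < Phi v) ->
  u_ @ \oo --> u -> Phi u <= limn_einf (Phi \o u_).
Proof.
move=> lsc cu; rewrite leNgt; apply/negP => /lte_between[r [lr ru]].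
suff : r%:E <= limn_einf (Phi \o u_) by rewrite leNgt lr.
have h : \forall n \near \oo, r%:E < Phi (u_ n) := cu _ (lsc _ ru).
by apply: le_limn_einf; apply: filterS h => n; exact: ltW.
Qed.

(** Lower semicontinuity of the cost jointly in the competitor and the point, the local hypothesis
    of the compact covering argument in [inf_conv_near_gt]. *)
Lemma near_sum_gt Phi1 Phi2 (u y : Y) (r : R) :
  lsc_seminorm Phi1 -> lsc_seminorm Phi2 ->
  r%:E < Phi1 (u - y)%R + Phi2 y ->
  \forall y' \near y & u' \near u, r%:E < Phi1 (u' - y')%R + Phi2 y'.
Proof.
move=> sn1 sn2 /lte_addP[||r1 [r2 [h1 h2 rle]]]; try exact: snorm_ge0.
have n1 := near_gt_of_seq_lsc _ _ _ (fun u_ => @snorm_lsc _ _ _ sn1 u_ _) h1.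
have n2 := near_gt_of_seq_lsc _ _ _ (fun u_ => @snorm_lsc _ _ _ sn2 u_ _) h2.
have csub : (fun p : Y * Y => (p.2 - p.1)%R) p @[p --> (y, u)] --> (u - y)%R.
  by apply: cvgB; [exact: cvg_snd|exact: cvg_fst].
have cfst : (fun p : Y * Y => p.1) p @[p --> (y, u)] --> y by exact: cvg_fst.
have m1 : \forall p \near nbhs (y, u), r1%:E < Phi1 (p.2 - p.1)%R := csub _ n1.
have m2 : \forall p \near nbhs (y, u), r2%:E < Phi2 p.1 := cfst _ n2.
apply: filterS2 m1 m2 => p p1 p2; apply: le_lt_trans (lteD p1 p2).
by rewrite -EFinD lee_fin.
Qed.

End LowerSemicontinuity.
Lemma continuous_linear_norm_le {R : realType} {V W : normedModType R}
    (f : {linear V -> W}) :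
  continuous f -> exists2 B : R, (0 < B)%R & forall x, (`|f x| <= B * `|x|)%R.
Proof.
move=> /linear_bounded_continuous/linear_boundedP/pinfty_ex_gt0[B B0 hB].
by exists B.
Qed.

(** * Infimal convolution relative to the embedding *)

Section InfConvEmbedding.
Context {R : realType} {X Y : completeNormedModType R}.
Variable j : {linear X -> Y}.

(** [w] lifts [u - P u], which coercivity bounds, and [z] lifts [P u], which lies in the kernel. *)
Lemma coercive_decomposition (Phi : Y -> \bar R) : lsc_seminorm Phi ->
  (forall u, Phi u < +oo -> range j u) -> coercive j Phi ->
  exists2 C : R, (0 < C)%R & forall u (s : R), Phi u <= s%:E ->
    exists w z, [/\ j (w + z)%R = u, fker Phi (j z) & (`|w| <= C * s)%R].
Proof.
move=> sn dom [P [_ rP _] [C C0 co]]; exists C => // u s us.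
have [x _ xu] : range j u by apply: dom; rewrite (le_lt_trans us) // ltry.
have [w jw wle] := co x; exists w, (x - w)%R; split.
- by rewrite addrC subrK.
- by rewrite -rP; exists u => //; rewrite linearB jw xu opprB addrC subrK.
- rewrite -lee_fin (le_trans wle) // EFinM lee_pmul2l ?xu //.
Qed.

Context (Phi1 Phi2 : Y -> \bar R) (Xj : continuous_embedding j)
    (sn1 : lsc_seminorm Phi1) (sn2 : lsc_seminorm Phi2)
    (dom1 : forall u : Y, Phi1 u < +oo -> range j u)
    (dom2 : forall u : Y, Phi2 u < +oo -> range j u)
    (co1 : coercive j Phi1) (co2 : coercive j Phi2)
    (fd1 : finite_dim (fker Phi1)) (fd2 : finite_dim (fker Phi2)).

Let K : set Y := set_sum (fker Phi1) (fker Phi2).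

Lemma fker_range : K `<=` range j.
Proof.
move=> _ [v v0 [w w0 <-]].
have [x _ <-] : range j v by apply: dom1; rewrite v0 ltry.
have [y _ <-] : range j w by apply: dom2; rewrite w0 ltry.
by exists (x + y)%R => //; rewrite linearD.
Qed.

Lemma inf_conv_ge_fin u (r : R) :
  (forall v s, Phi1 (u - v)%R + Phi2 v <= s%:E -> (r <= s)%R) ->
  r%:E <= inf_conv Phi1 Phi2 u.
Proof.
move=> h; apply: le_inf_conv => v fv.
have fin : Phi1 (u - v)%R + Phi2 v \is a fin_num.
  by rewrite ge0_fin_numE // adde_ge0 // snorm_ge0.
by rewrite -(fineK fin) lee_fin; apply: (h v); rewrite fineK.
Qed.

(** [u - v] and [v] are decomposed separately; each has cost at most [s] because the other cost is
    nonnegative. *)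
Lemma inf_conv_decomposition : exists2 C : R, (0 < C)%R &
  forall u v (s : R), Phi1 (u - v)%R + Phi2 v <= s%:E ->
    exists w1 w2 z1 z2, [/\ u = j (w1 + z1 + (w2 + z2))%R,
      v = j (w2 + z2)%R, fker Phi1 (j z1) /\ fker Phi2 (j z2),
      (`|w1| <= C * s)%R & (`|w2| <= C * s)%R].
Proof.
have [C1 C10 h1] := coercive_decomposition _ sn1 dom1 co1.
have [C2 C20 h2] := coercive_decomposition _ sn2 dom2 co2.
exists (C1 + C2)%R => [|u v s us]; first exact: addr_gt0.
have p1 := snorm_ge0 sn1 (u - v)%R; have p2 := snorm_ge0 sn2 v.
have s0 : (0 <= s)%R by rewrite -lee_fin (le_trans _ us) // adde_ge0.
have [|w1 [z1 [e1 k1 n1]]] := h1 (u - v)%R s.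
  by rewrite (le_trans _ us) // leeDl.
have [|w2 [z2 [e2 k2 n2]]] := h2 v s; first by rewrite (le_trans _ us) // leeDr.
exists w1, w2, z1, z2; split=> //.
- by rewrite linearD e1 e2 subrK.
- by rewrite (le_trans n1) // ler_wpM2r // lerDl ltW.
- by rewrite (le_trans n2) // ler_wpM2r // lerDr ltW.
Qed.

Lemma kernel_sum_lift_bound : exists2 D : R, (0 < D)%R &
  forall x, K (j x) -> (`|x| <= D * `|j x|)%R.
Proof.
have [jinj _] := Xj; have [fdK _] := finite_dim_sum_decomposition _ _ fd1 fd2.
have [D D0 hD] := finite_dim_lift_bound _ j _ jinj fdK fker_range.
exists (D + 1)%R => [|x /hD xle]; first by rewrite ltr_wpDl.
by rewrite (le_trans xle) // ler_wpM2r // lerDl.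
Qed.

Lemma norm_le_inf_conv : exists2 c : R, (0 < c)%R &
  forall x, (c * `|x|)%:E <= `|j x|%:E + inf_conv Phi1 Phi2 (j x).
Proof.
have [_ /continuous_linear_norm_le[J J0 hJ]] := Xj.
have [C C0 hC] := inf_conv_decomposition.
have [D D0 hD] := kernel_sum_lift_bound.
(* With [w = w1 + w2] and [z = z1 + z2], the norm of [x] is at most [D] times that of [j x] plus
   [(1 + D * J) * (C + C) * s]; [M] adds the two coefficients. *)
set M := (D + (1 + D * J) * (C + C))%R.
have DJ : (0 < 1 + D * J)%R by rewrite ltr_pwDl // mulr_ge0 // ltW.
have M0 : (0 < M)%R by rewrite addr_gt0 // mulr_gt0 // addr_gt0.
exists M^-1%R => [|x]; first by rewrite invr_gt0.
rewrite -leeBlDl // -EFinB; apply: inf_conv_ge_fin => v s xs.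
have [w1 [w2 [z1 [z2 [xE _ [k1 k2] n1 n2]]]]] := hC _ _ _ xs.
have xE' : x = (w1 + w2 + (z1 + z2))%R.
  by have [jinj _] := Xj; rewrite addrACA; exact: jinj.
have s0 : (0 <= s)%R.
  by rewrite -lee_fin (le_trans _ xs) // adde_ge0 // snorm_ge0.
have Kz : K (j (z1 + z2)%R) by rewrite linearD; exists (j z1) => //; exists (j z2).
have nw : (`|w1 + w2| <= (C + C) * s)%R.
  by rewrite (le_trans (ler_normD _ _)) // mulrDl lerD.
have nz : (`|j (z1 + z2)| <= `|j x| + J * ((C + C) * s))%R.
  rewrite (_ : j (z1 + z2) = j x - j (w1 + w2))%R; last first.
    by rewrite [in RHS]xE' [in RHS]linearD addrAC subrr add0r.
  rewrite (le_trans (ler_normB _ _)) // lerD2l (le_trans (hJ _)) //.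
  by rewrite ler_wpM2l // ltW.
rewrite lerBlDl -ler_pdivlMl ?invr_gt0// invrK.
rewrite [in leLHS]xE' (le_trans (ler_normD _ _)) //.
have : (`|z1 + z2| <= D * (`|j x| + J * ((C + C) * s)))%R.
  by rewrite (le_trans (hD _ Kz)) // ler_wpM2l // ltW.
(* [t0] and [Ds] are the surplus terms created by using [M] for both coefficients. *)
have t0 : (0 <= (1 + D * J) * (C + C) * `|j x|)%R.
  by rewrite mulr_ge0 // ltW // mulr_gt0 // addr_gt0.
have Ds : (0 <= D * s)%R by rewrite mulr_ge0 // ltW.
rewrite /M; move: nw t0 Ds.
move: `|_|%R `|_|%R `|_|%R => a b c *; lra.
Qed.

Lemma norm_equivalence_inf_conv :
  norm_equivalence j Phi1 -> norm_equivalence j (inf_conv Phi1 Phi2).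
Proof.
move=> [c0 [C [_ _ hC]]]; have [c c_gt0 hc] := norm_le_inf_conv.
(* The entry [c + 1] makes the inequality between the two constants strict. *)
exists c, (Num.max C (c + 1))%R; split=> //.
  by rewrite lt_max ltrDl ltr01 orbT.
move=> u; rewrite hc /=; have /andP[_ uC] := hC u.
apply: le_trans (_ : (C * `|u|)%:E <= _); last first.
  by rewrite lee_fin ler_wpM2r // le_max lexx.
(* The competitor [0] bounds the convolution by [Phi1]. *)
apply: le_trans uC; rewrite leeD2l // (le_trans (inf_conv_le _ _ _ 0%R)) //.
by rewrite subr0 seminorm0 // adde0.
Qed.

(** [P] fixes the part of [j x] in [K], so [j x - P (j x)] depends only on [w1 + w2]. The range is
    given as [K] because [fker_inf_conv] is deduced from this estimate. *)
Lemma inf_conv_coercive_along (P : {linear Y -> Y}) :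
  continuous P -> range P = K -> (forall u, P (P u) = P u) ->
  coercive_along j (inf_conv Phi1 Phi2) P.
Proof.
move=> Pc rP PP; have [jinj jc] := Xj.
have [J J0 hJ] := continuous_linear_norm_le j jc.
have [B B0 hB] := continuous_linear_norm_le P Pc.
have [C C0 hC] := inf_conv_decomposition.
have [D D0 hD] := kernel_sum_lift_bound.
have PK k : K k -> P k = k by rewrite -rP => -[y _ <-].
have KP y : K (P y) by rewrite -rP; exists y.
(* The lift [q] of [P (j (w1 + w2))] has norm at most [D * (B * J)] times that of [w1 + w2], and
   [x - z = w1 + w2 - q]. *)
pose M := ((1 + D * (B * J)) * (C + C))%R.
have M0 : (0 < M)%R.
  by rewrite mulr_gt0 ?addr_gt0 // !mulr_gt0.
exists M => // x; have [z _ jz] := fker_range _ (KP (j x)).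
exists (x - z)%R; first by rewrite linearB jz.
rewrite -lee_pdivrMl // -EFinM; apply: inf_conv_ge_fin => v s xs.
have [w1 [w2 [z1 [z2 [xE _ [k1 k2] n1 n2]]]]] := hC _ _ _ xs.
have {}xE : x = (w1 + w2 + (z1 + z2))%R by rewrite addrACA; exact: jinj.
have Kz : K (j (z1 + z2)%R) by rewrite linearD; exists (j z1) => //; exists (j z2).
have [q _ jq] := fker_range _ (KP (j (w1 + w2)%R)).
have zE : z = (q + (z1 + z2))%R.
  by apply: jinj; rewrite jz xE (linearD j (w1 + w2)%R) (linearD P) (PK _ Kz) -jq -linearD.
have nw : (`|w1 + w2| <= (C + C) * s)%R.
  by rewrite (le_trans (ler_normD _ _)) // mulrDl lerD.
rewrite ler_pdivrMl // xE zE [(q + _)%R]addrC addrKA.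
rewrite (le_trans (ler_normB _ _)) //.
apply: le_trans (_ : `|w1 + w2| + D * (B * J) * `|w1 + w2| <= _)%R.
  rewrite lerD2l; apply: le_trans (hD q _) _; first by rewrite jq.
  rewrite -mulrA ler_wpM2l ?(ltW D0) // jq (le_trans (hB _)) // -mulrA.
  by rewrite ler_wpM2l // ltW.
rewrite -[X in (X + _ <= _)%R]mul1r -mulrDl /M -mulrA ler_wpM2l //.
by rewrite addr_ge0 // !mulr_ge0 // ltW.
Qed.

Lemma fker_inf_conv : fker (inf_conv Phi1 Phi2) = K.
Proof.
apply/seteqP; split=> [u u0|u]; last exact: inf_conv_set_sum.
have [fdK _] := finite_dim_sum_decomposition _ _ fd1 fd2.
have [P [Pc rP PP]] := finite_dim_projection _ fdK.
have [C C0 hC] := inf_conv_coercive_along P Pc rP PP.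
(* A competitor of finite cost places [u] in the range of [j], where coercivity forces [u = P u]. *)
have [v] : exists v, Phi1 (u - v)%R + Phi2 v <= 1%:E.
  have : inf_conv Phi1 Phi2 u < 1%:E by rewrite u0 lte_fin.
  by move=> /ereal_inf_lt[_ [v _ <-] /ltW]; exists v.
have [E _ hE] := inf_conv_decomposition.
move=> /hE[w1 [w2 [z1 [z2 [uE _ _ _ _]]]]].
have [w jw] := hC (w1 + z1 + (w2 + z2))%R.
rewrite -uE u0 mule0 lee_fin normr_le0 => /eqP w0; move: jw.
rewrite w0 linear0 -uE => /esym/eqP; rewrite subr_eq0 => /eqP ->.
by have : range P (P u) by [exists u]; rewrite rP.
Qed.

Lemma inf_conv_projection :
  exists P, kernel_projection (inf_conv Phi1 Phi2) P.
Proof.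
have [fdK _] := finite_dim_sum_decomposition _ _ fd1 fd2.
have [P [Pc rP PP]] := finite_dim_projection _ fdK.
by exists P; split=> //; rewrite fker_inf_conv.
Qed.

(* The defect of an almost optimal v is corrected inside the kernels, where the
   functionals do not see it: only w2 and a bounded kernel element survive. *)
Lemma inf_conv_bounded_competitor (N s : R) : exists M : R,
  forall u v, (`|u| <= N)%R -> Phi1 (u - v)%R + Phi2 v <= s%:E ->
    exists2 y, (`|y| <= M)%R & Phi1 (u - j y)%R + Phi2 (j y) <= s%:E.
Proof.
have [_ /continuous_linear_norm_le[J J0 hJ]] := Xj.
have [C C0 hC] := inf_conv_decomposition.
have [D D0 hD] := kernel_sum_lift_bound.
have [_ [E E0 hE]] := finite_dim_sum_decomposition _ _ fd1 fd2.
(* The first term bounds [w2]. The second bounds the lift of [b] through [D] and [E], with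
   [j (z1 + z2)] estimated as [u - j (w1 + w2)]. *)
exists (C * s + D * (E * (N + J * (C * s + C * s))))%R => u v uN us.
have [w1 [w2 [z1 [z2 [uE vE [k1 k2] n1 n2]]]]] := hC _ _ _ us.
have {}uE : u = (j (w1 + w2) + j (z1 + z2))%R by rewrite -linearD addrACA.
have Kz : K (j (z1 + z2)%R) by rewrite linearD; exists (j z1) => //; exists (j z2).
(* Only the sum of [j z1] and [j z2] is under control, as opposite shifts in a common kernel leave
   it unchanged; it is split anew with bounded parts. *)
have [a [b [ka kb abE _ nb]]] := hE _ Kz.
have [y _ jy] : range j b by apply: dom2; rewrite kb ltry.
have Ky : K (j y).
  by exists 0%R; [exact: seminorm0|exists b => //; rewrite add0r jy].
exists (w2 + y)%R.
  rewrite (le_trans (ler_normD _ _)) // lerD // (le_trans (hD _ Ky)) // jy.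
  rewrite ler_wpM2l ?(ltW D0) // (le_trans nb) // ler_wpM2l //.
  rewrite (_ : j (z1 + z2) = u - j (w1 + w2))%R; last by rewrite uE addrAC subrr add0r.
  rewrite (le_trans (ler_normB _ _)) // lerD // (le_trans (hJ _)) //.
  by rewrite ler_wpM2l ?(ltW J0) // (le_trans (ler_normD _ _)) // lerD.
have -> : (u - j (w2 + y) = j w1 + a)%R.
  by rewrite uE -abE (linearD j w1) (linearD j w2) jy addrACA addrK.
have -> : Phi2 (j (w2 + y)%R) = Phi2 v.
  by rewrite vE !linearD jy !seminorm_kerD.
suff <- : Phi1 (u - v)%R = Phi1 (j w1 + a)%R by [].
rewrite (_ : u - v = j w1 + j z1)%R ?seminorm_kerD // uE vE.
by rewrite (linearD j w1) (linearD j z1) (linearD j w2) addrACA addrK.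
Qed.

Lemma inf_conv_near_gt u (r : R) : compact_embedding j ->
  r%:E < inf_conv Phi1 Phi2 u ->
  \forall u' \near u, r%:E < inf_conv Phi1 Phi2 u'.
Proof.
(* The gap between [r] and [s] supplies a competitor of cost at most [s] whenever the convolution is
   at most [r], without attainment of the infimum. *)
move=> [_ jK] /lte_between[s [rs su]].
have [M hM] := inf_conv_bounded_competitor (`|u| + 1)%R s.
pose B : set X := [set x | (`|x| <= M)%R].
have /jK : bounded_set B.
  exists M; split=> [|t Mt x xM]; first exact: num_real.
  by rewrite /= (le_trans xM) // ltW.
rewrite precompactE => /compact_near_coveringP cK.
(* Compactness provides one neighbourhood of [u] on which the cost exceeds [s] for every [y] in the
   closure at once. *)
have near_cover : \forall u' \near u,
    closure (j @` B) `<=` [set y | s%:E < Phi1 (u' - y)%R + Phi2 y].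
  apply: (cK Y (nbhs u) (fun u' y => s%:E < Phi1 (u' - y)%R + Phi2 y)).
  move=> y _; apply: near_sum_gt => //.
  exact: lt_le_trans su (inf_conv_le _ _ _ _).
have near_norm : \forall u' \near u, (`|u'| <= `|u| + 1)%R.
  apply/nbhs_normP; exists 1%R => //= u' uu'.
  rewrite -[u'](subrK u) addrC (le_trans (ler_normD _ _)) // lerD2l distrC.
  exact: ltW.
apply: filterS2 near_cover near_norm => u' cov nu'; rewrite ltNge.
apply/negP => /le_lt_trans-/(_ _ rs)/ereal_inf_lt[_ [v _ <-] /ltW vs].
have [y yM ys] := hM _ _ nu' vs.
have /cov/= : closure (j @` B) (j y) by apply: subset_closure; exists y.
by rewrite ltNge ys.
Qed.

Lemma lsc_seminorm_inf_conv : compact_embedding j ->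
  lsc_seminorm (inf_conv Phi1 Phi2).
Proof.
move=> jK; split.
- exact: inf_conv_ge0.
- by exists 0%R; rewrite inf_conv0 // ltry.
- by move=> a u; exact: inf_convZ.
- by move=> u v; exact: inf_convD.
- move=> u_ u; apply: seq_lsc_of_near_gt => r; exact: inf_conv_near_gt.
- exact: inf_conv_projection.
Qed.

End InfConvEmbedding.


(* dom1 and dom2 spell out the convention that the X-norm is +oo on Y \ X in the
   norm estimates; without them the claim fails when Phi1 and Phi2 are finite at
   points of Y outside X. *)
Theorem proposition5 (R : realType) (X Y : completeNormedModType R)
    (j : {linear X -> Y}) (Phi1 Phi2 : Y -> \bar R)
    (Xj : continuous_embedding j)
    (sn1 : lsc_seminorm Phi1) (sn2 : lsc_seminorm Phi2)
    (dom1 : forall u : Y, Phi1 u < +oo -> range j u)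
    (dom2 : forall u : Y, Phi2 u < +oo -> range j u)
    (co1 : coercive j Phi1) (co2 : coercive j Phi2)
    (fd1 : finite_dim (fker Phi1)) (fd2 : finite_dim (fker Phi2))
    (ne1 : norm_equivalence j Phi1) (ne2 : norm_equivalence j Phi2) :
  norm_equivalence j (inf_conv Phi1 Phi2) /\
  (compact_embedding j ->
    [/\ lsc_seminorm (inf_conv Phi1 Phi2),
        coercive j (inf_conv Phi1 Phi2),
        fker (inf_conv Phi1 Phi2) = set_sum (fker Phi1) (fker Phi2) &
        forall P : {linear Y -> Y},
          kernel_projection (inf_conv Phi1 Phi2) P ->
          coercive_along j (inf_conv Phi1 Phi2) P]).
Proof.
split=> [|jK]; first exact: norm_equivalence_inf_conv.
have kerE := fker_inf_conv _ _ _ Xj sn1 sn2 dom1 dom2 co1 co2 fd1 fd2.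
have co P : kernel_projection (inf_conv Phi1 Phi2) P ->
    coercive_along j (inf_conv Phi1 Phi2) P.
  by move=> [Pc rP PP]; apply: inf_conv_coercive_along => //; rewrite rP kerE.
have [P KP] := inf_conv_projection _ _ _ Xj sn1 sn2 dom1 dom2 co1 co2 fd1 fd2.
split=> //; first exact: (lsc_seminorm_inf_conv j).
by exists P => //; exact: co.
Qed.
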